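(* For every real $p\ge 1$ there exist constants $A_p,B_p>0$, depending only on $p$, such that the following holds. Let $\{X_n\}_{n\ge1}$ be a sequence of nonnegative random variables on a probability space $(\Omega,\mathbf{F},\mathbb{P})$ with finite $p$-th moment and respective expected values $\{\mu_n\}$. Let $S_n:=\sum_{k=1}^n X_k$ and $z_n:=\sum_{i=1}^n\mu_i$. Suppose there exists a sequence of nonnegative real numbers $\{\gamma_n\}_{n\ge1}$ satisfying $$\mathbb{E}(|S_n-z_n|^p)\le\sum_{k=1}^n\gamma_k\quad\text{for all } n\ge 1,$$ and $$\sum_{m=1}^\infty\frac{\gamma_m}{m^p}\le\Gamma$$ for some $\Gamma\ge 1$, with the partial sums of the latter series converging to their limit with a strictly decreasing rate of convergence $\Psi$. Furthermore, assume that for all $n\ge 1$, $$\frac{z_n}{n}\le W$$ for some $W\ge 1$. Then for all $0<\varepsilon\le 1$, all $\lambda>0$ and all integers $n\ge1$ with $$n\ge A_p\left(\frac{W\Gamma}{\lambda\varepsilon^{p+1}}\right)^{\frac1p}\Psi\left(\frac{B_p\lambda\varepsilon^{p+1}}{W}\right),$$ it holds that $$\mathbb{P}\left(\sup_{m\ge n}\left|\frac{S_m}{m}-\frac{z_m}{m}\right|>\varepsilon\right)\le\lambda.$$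
   Context: A rate of convergence for the partial sums of a convergent series $\sum_{i=1}^\infty x_i<\infty$ of nonnegative reals is a function $r:(0,\infty)\to(0,\infty)$ such that for all $\varepsilon>0$ and all natural numbers $n\ge r(\varepsilon)$, $\sum_{i=n+1}^\infty x_i\le\varepsilon$.
   Formalization: In the lower bound on n, the factor Ψ(B_pλε^{p+1}/W) is replaced by max(1, Ψ(B_pλε^{p+1}/W)); as stated the claim fails for rates taking values below 1 (e.g. X_1 uniform on {0,2}, X_k=0 for k≥2, Ψ arbitrarily small). *)

(* Defs.v *)
From HB Require Import structures.
From mathcomp Require Import all_boot all_order all_algebra.
From mathcomp Require Import all_classical all_reals all_analysis.
Set Implicit Arguments.
Unset Strict Implicit.
Unset Printing Implicit Defensive.
Import Order.TTheory GRing.Theory Num.Theory.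
Import numFieldNormedType.Exports.
Local Open Scope ring_scope.

(* Sequences indexed by the positive integers are functions on nat whose value
   at 0 is never used.  Likewise a function on (0, +oo) is a function on R whose
   values outside (0, +oo) are never used. *)

(* A rate may take values below 1.  Every index n >= 1 is above such values, so
   they carry no more information than the value 1: if x i = 0 for all i >= 2,
   every positive function is a rate.  A threshold for n that is proportional to
   a rate must therefore use Num.max 1 (r e) in place of r e. *)
Definition rate_of_convergence (R : realType) (x : nat -> R) (r : R -> R) : Prop :=
  (forall e : R, 0 < e -> 0 < r e) /\
  (forall (e : R) (n : nat), 0 < e -> r e <= n%:R ->
     (\sum_(n.+1 <= i <oo) (x i)%:E <= e%:E)%E).

Definition strictly_decreasing_pos (R : realType) (r : R -> R) : Prop :=
  forall a b : R, 0 < a -> a < b -> r b < r a.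

Definition psum (R : realType) (u : nat -> R) (n : nat) : R :=
  \sum_(1 <= k < n.+1) u k.

(* Main.v *)
Require Import Defs.
From HB Require Import structures.
From mathcomp Require Import all_boot all_order all_algebra.
From mathcomp Require Import all_classical all_reals all_analysis.
From mathcomp Require Import measurable_realfun.
From mathcomp Require Import ring lra zify.
Set Implicit Arguments.
Unset Strict Implicit.
Unset Printing Implicit Defensive.
Import Order.TTheory GRing.Theory Num.Theory.
Import numFieldNormedType.Exports.
Local Open Scope classical_set_scope.
Local Open Scope ring_scope.

(** The partial sums [S] are nondecreasing, so a deviation [S m - z m] cannot
    hide between two indices at which [z] takes nearly the same value: if
    [a <= m <= b] and [z a], [z m], [z b] differ by less than [h], then a
    deviation of [S] from [z] by [2h] at [m] is a deviation by at least [h] at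
    [b] (if [S m] is too large) or at [a] (if [S m] is too small).

    Cut the indices [m >= n] into the dyadic blocks [M <= m < 2M], where
    [M = n * 2 ^ k].  On such a block [z] takes values in [0, 2WM], so it meets
    at most [1 + 4W/eps] of the cells [j * h, (j+1) * h) of length
    [h = eps * M / 2].  The first and the last index of each cell are
    checkpoints for the whole block ([deviation_checkpoints]), and Markov's
    inequality for the [p]-th moment together with a union bound over the
    checkpoints yields, with [G m := psum gamma m], a probability of order
    [(W / eps) * G (2M) / (eps * M) ^ p] ([block_exceptional_set]).  Cutting by
    the value of [z], and not by the value of [z m / m] within shorter
    geometric blocks, is what makes the bound linear in [W / eps].

    The averages [a k = G (n * 2 ^ k) / (n * 2 ^ k) ^ p] satisfy
    [a (k+1) <= a k / 2 + (part of the series over the k-th block)], so their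
    sum is controlled by [a 0] and by the tail of the series
    [gamma m / m ^ p] after [n] ([dyadic_average_sum_le]).  This gives

      [P (exists m >= n, |S m - z m| > eps * m)
         <= C * W / eps ^ (p+1) * (G n / n ^ p + 2 * tail n)]

    with [C = 10 * 4 ^ p] ([maximal_inequality]).  Finally, for any [N <= n] the
    average [G n / n ^ p] is at most [(N / n) ^ p * Gamma] plus the part of the
    series between [N] and [n] ([psum_split_average]).  Taking for [N] an
    integer between [max 1 (Psi delta)] and its double, with
    [delta = lambda * eps ^ (p+1) / (4 C W)], makes the series contribute at
    most [lambda / 2], and the lower bound on [n] is what makes
    [(N / n) ^ p * Gamma] contribute at most [lambda / 2] as well
    ([rate_threshold]). *)

(** * Checkpoints for a monotone sequence on a dyadic block *)

(** For a value [j] that [s] does not take on the block, any pair of indices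
    inside the block will do; providing one keeps the statement total in [j]. *)
Lemma fiber_ends (s : nat -> nat) (M j : nat) : (0 < M)%N ->
  exists ab : nat * nat,
    [/\ (M <= ab.1 < M.*2)%N, (M <= ab.2 < M.*2)%N &
      forall m, (M <= m < M.*2)%N -> s m = j ->
        [/\ (ab.1 <= m <= ab.2)%N, s ab.1 = j & s ab.2 = j]].
Proof.
move=> M0; pose Q m := (M <= m < M.*2)%N && (s m == j).
have [exQ|noQ] := pselect (exists m, Q m); last first.
  exists (M, M); split=> /= [||m Mm sm]; [lia|lia|].
  by exfalso; apply: noQ; exists m; rewrite /Q Mm sm eqxx.
have Qlt m : Q m -> (m <= M.*2)%N by case/andP; lia.
have [/= a /andP[Ma /eqP sa] amin] := ex_minnP exQ.
have [/= b /andP[Mb /eqP sb] bmax] := ex_maxnP exQ Qlt.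
exists (a, b); split=> //= m Mm sm.
have Qm : Q m by rewrite /Q Mm sm eqxx.
by split=> //; rewrite amin // bmax.
Qed.

(** The checkpoints are the first and last index of each cell
    [j * h, (j+1) * h) of values of [z].  They depend on [z] only, so that one
    choice serves all the trajectories [S] of a random sequence.  [S] is
    compared along [a <= m <= b], and [z] through membership in the cell. *)
Lemma deviation_checkpoints (R : realType) (z : nat -> R) (M : nat) (h : R) :
  (0 < M)%N -> 0 < h -> (forall m, 0 <= z m) ->
  exists ab : nat -> nat * nat,
    [/\ forall j, (M <= (ab j).1 < M.*2)%N,
        forall j, (M <= (ab j).2 < M.*2)%N &
      forall (S : nat -> R) (m : nat), {homo S : i j / (i <= j)%N >-> i <= j} ->
        (M <= m < M.*2)%N -> h + h <= `|S m - z m| ->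
        let j := Num.truncn (z m / h) in
        h <= `|S (ab j).1 - z (ab j).1| \/ h <= `|S (ab j).2 - z (ab j).2| ].
Proof.
move=> M0 h0 z0; pose s m := Num.truncn (z m / h).
have [ab abP] := choice (fun j => fiber_ends s j M0).
exists ab; split=> [j|j|S m Shomo Mm dev /=]; [by case: (abP j)..|].
have [_ _ /(_ m Mm erefl)] := abP (s m).
rewrite -/(s m); case: (ab (s m)) => a b /= [/andP[am mb] sa sb].
have cell i : (s m)%:R * h <= z i < (s m).+1%:R * h \/ s i <> s m.
  have [e|] := eqVneq (s i) (s m); [left|by right; apply/eqP].
  have /truncn_itv : 0 <= z i / h by rewrite divr_ge0// ltW.
  by rewrite -/(s i) e ler_pdivlMr// ltr_pdivrMr.
have [/andP[]|//] := cell m; have [/andP[]|//] := cell a.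
have [/andP[]|//] := cell b.
rewrite -natr1 mulrDl mul1r => b1 b2 a1 a2 m1 m2.
have Sam := Shomo _ _ am; have Smb := Shomo _ _ mb.
(* An excess of S at m persists at the last index of the cell, a deficit is
   already present at the first. *)
by move: dev; rewrite !ler_normr => /orP[] dev; [right|left]; apply/orP;
  [left|right]; lra.
Qed.

(** * Probability of a deviation inside one block *)

Lemma markov_powR (R : realType) (d : measure_display) (T : measurableType d)
    (P : probability T R) (Y : T -> R) (p h g : R) :
  measurable_fun setT Y -> 0 <= p -> 0 < h ->
  ('E_P[fun w => (`|Y w| `^ p)%R] <= g%:E)%E ->
  (P [set w | (h <= `|Y w|)%R] <= (g / h `^ p)%:E)%E.
Proof.
move=> mY p0 h0 Yg.
have := @markov _ _ _ P (mfun_Sub (mem_set mY)) (fun x => x `^ p) h h0.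
move=> /(_ (measurable_powR _)) /(_ (fun r _ => powR_ge0 r p)).
move=> /(_ (ge0_ler_powR p0)) mk.
rewrite EFinM lee_pdivlMr ?powR_gt0// muleC.
apply: le_trans Yg; exact: mk.
Qed.

(** The exceptional set [F] is the union over the [J] cells of the deviation
    events at their two checkpoints, hence the factor [2 * J].  Since all
    checkpoints lie below [2M], one moment bound [G (2M)] serves for all. *)
Lemma block_exceptional_set (R : realType) (d : measure_display)
    (T : measurableType d) (P : probability T R) (p h : R)
    (S : nat -> T -> R) (z G : nat -> R) (M J : nat) :
  (0 < M)%N -> 0 < h -> 0 <= p -> (forall m, 0 <= z m) ->
  (forall m, measurable_fun setT (S m)) ->
  (forall w, {homo S^~ w : i j / (i <= j)%N >-> i <= j}) ->
  {homo G : i j / (i <= j)%N >-> i <= j} ->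
  (forall m, (1 <= m)%N ->
     ('E_P[fun w => (`|S m w - z m| `^ p)%R] <= (G m)%:E)%E) ->
  (forall m, (M <= m < M.*2)%N -> z m < J%:R * h) ->
  exists F : set T,
    [/\ measurable F, (P F <= ((G M.*2 / h `^ p) *+ 2 *+ J)%:E)%E &
      forall m w, (M <= m < M.*2)%N -> h + h <= `|S m w - z m| -> F w].
Proof.
move=> M0 h0 p0 z0 mS Shomo Ghomo SG zJ.
have [ab [aM bM abP]] := deviation_checkpoints M0 h0 z0.
pose dev m := [set w | h <= `|S m w - z m|].
have mdev m : measurable (dev m).
  rewrite -[dev m]setTI; apply: measurable_fun_le => //.
  apply: measurableT_comp => //; exact: measurable_funB.
have Pdev m : (M <= m < M.*2)%N -> (P (dev m) <= (G M.*2 / h `^ p)%:E)%E.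
  move=> /andP[Mm m2M]; apply: markov_powR => //; first exact: measurable_funB.
  apply: (le_trans (SG _ _)); first by lia.
  by rewrite lee_fin Ghomo// ltnW.
pose D j := dev (ab j).1 `|` dev (ab j).2.
have mD j : measurable (D j) by exact: measurableU.
have PD j : (P (D j) <= ((G M.*2 / h `^ p) *+ 2)%:E)%E.
  have := measureU2 P (mdev (ab j).1) (mdev (ab j).2); move=> /le_trans; apply.
  by rewrite mulr2n EFinD leeD// Pdev.
exists (\big[setU/set0]_(j < J) D j); split.
- exact: bigsetU_measurable.
- have := content_subadditive P
    (A := \big[setU/set0]_(j < J) D j) (F := D) (n := J).
  move=> /(_ _ _ _)/le_trans; apply => //.
    exact: bigsetU_measurable.
  apply: (@le_trans _ _ (\sum_(j < J) ((G M.*2 / h `^ p) *+ 2)%:E)%E).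
    by apply: lee_sum => j _; exact: PD.
  by rewrite sumEFin lee_fin sumr_const card_ord.
- move=> m w Mm Sm; rewrite -bigcup_mkord.
  exists (Num.truncn (z m / h)); last exact: (abP (S^~ w) m).
  rewrite /= -(ltr_nat R); apply: le_lt_trans (_ : z m / h < _).
    by have /truncn_itv/andP[] : 0 <= z m / h by rewrite divr_ge0// ltW.
  by rewrite ltr_pdivrMr// zJ.
Qed.

(** * Summing the averages along the dyadic sequence *)

Lemma psum_nondecreasing (R : realType) (u : nat -> R) :
  (forall k, (1 <= k)%N -> 0 <= u k) ->
  {homo psum u : i j / (i <= j)%N >-> i <= j}.
Proof.
move=> u0 i j ij; rewrite /psum (big_cat_nat _ (n := i.+1) (p := j.+1))//=.
rewrite lerDl big_nat sumr_ge0// => k /andP[ik _]; apply: u0; lia.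
Qed.

(** Doubling the index divides the contribution of the earlier terms by
    [2 ^ p >= 2], and a new term [gamma m] is divided by at least [m ^ p]:
    twice an average is at most the previous average plus twice the new part
    of the series.  Keeping the last average on the left-hand side makes this
    recursion telescope. *)
Lemma dyadic_average_sum_le (R : realType) (p : R) (gamma : nat -> R)
    (n K : nat) :
  1 <= p -> (forall k, (1 <= k)%N -> 0 <= gamma k) -> (1 <= n)%N ->
  \sum_(k < K) psum gamma (n * 2 ^ k.+1) / (n * 2 ^ k.+1)%:R `^ p
    + psum gamma (n * 2 ^ K) / (n * 2 ^ K)%:R `^ p <=
  psum gamma n / n%:R `^ p
    + 2 * \sum_(n.+1 <= m < (n * 2 ^ K).+1) gamma m / m%:R `^ p.
Proof.
move=> p1 g0 n1; pose a k := psum gamma (n * 2 ^ k) / (n * 2 ^ k)%:R `^ p.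
rewrite -/(a K); elim: K => [|K IH].
  by rewrite big_ord0 /a expn0 muln1 big_geq// mulr0 add0r addr0.
have T0 k : (0 < n * 2 ^ k)%N by rewrite muln_gt0 n1 expn_gt0.
have TS k : (n * 2 ^ k.+1 = (n * 2 ^ k) * 2)%N by rewrite expnSr mulnA.
set D := \sum_((n * 2 ^ K).+1 <= m < (n * 2 ^ K.+1).+1) gamma m / m%:R `^ p.
have step : 2 * a K.+1 <= a K + 2 * D.
  have -> : a K.+1 = psum gamma (n * 2 ^ K) / (n * 2 ^ K.+1)%:R `^ p +
     \sum_((n * 2 ^ K).+1 <= m < (n * 2 ^ K.+1).+1)
        gamma m / (n * 2 ^ K.+1)%:R `^ p.
    by rewrite -mulr_suml -mulrDl /a /psum -big_cat_nat//= TS; lia.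
  rewrite mulrDr lerD//.
    have s0 : 0 <= psum gamma (n * 2 ^ K).
      by rewrite /psum big_nat sumr_ge0// => i /andP[i1 _]; exact: g0.
    have two : 2 <= (2 : R) `^ p by apply: le1r_powR => //; lra.
    rewrite TS natrM powRM// invfM.
    rewrite (mulrA (psum _ _)) -/(a K) mulrCA ler_piMr//.
      by rewrite divr_ge0// powR_ge0.
    by rewrite ler_pdivrMr ?mul1r//; lra.
  rewrite ler_pM2l// ler_sum_nat// => i /andP[i1 i2].
  have i0 : (0 < i)%N by lia.
  rewrite ler_wpM2l ?g0// lef_pV2 ?posrE ?powR_gt0 ?ltr0n//.
  by rewrite ge0_ler_powR ?nnegrE ?ler_nat//; lra.
rewrite big_ord_recr/= -/(a K.+1).
rewrite (big_cat_nat _ (n := (n * 2 ^ K).+1))//=; last 2 first.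
  by rewrite ltnS leq_pmulr// expn_gt0.
  by rewrite TS; lia.
rewrite -/D; lra.
Qed.

(** * The maximal inequality *)

Lemma measure_bigcup_le_sum_bound (R : realType) (d : measure_display)
    (T : measurableType d) (mu : {measure set T -> \bar R}) (E : set T)
    (F : nat -> set T) (u : nat -> R) (c : R) :
  measurable E -> (forall k, measurable (F k)) -> E `<=` \bigcup_k F k ->
  (forall k, (mu (F k) <= (u k)%:E)%E) ->
  (forall K, \sum_(k < K) u k <= c) -> (mu E <= c%:E)%E.
Proof.
move=> mE mF EF muu uc.
have := measure_sigma_subadditive mu mF mE EF; move=> /le_trans; apply.
apply: lime_le; first by apply: is_cvg_nneseries => *; exact: measure_ge0.
near=> K; rewrite big_mkord.
apply: (@le_trans _ _ (\sum_(k < K) (u k)%:E)%E); first exact: lee_sum.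
by rewrite sumEFin lee_fin.
Unshelve. all: by end_near. Qed.

Lemma dyadic_block (n m : nat) : (1 <= n <= m)%N ->
  exists k, (n * 2 ^ k <= m < (n * 2 ^ k).*2)%N.
Proof.
move=> /andP[n1 nm]; exists (trunc_log 2 (m %/ n)).
have : (0 < m %/ n)%N by rewrite divn_gt0.
move=> /(trunc_log_bounds (isT : 1 < 2)%N) /=.
rewrite expnS leq_divRL// ltn_divLR// mulnC => /andP[-> /=].
by rewrite -mul2n -mulnA (mulnC n).
Qed.

Lemma measurable_deviations (R : realType) (d : measure_display)
    (T : measurableType d) (S : nat -> T -> R) (z r : nat -> R) (I : set nat) :
  (forall m, measurable_fun setT (S m)) ->
  measurable (\bigcup_(m in I) [set w | (r m < `|S m w - z m|)%R]).
Proof.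
move=> mS; apply: bigcup_measurable => m _.
rewrite (_ : [set w | _] = ~` [set w | (`|S m w - z m| <= r m)%R]).
  apply: measurableC; rewrite -[X in measurable X]setTI.
  apply: measurable_fun_le => //.
  by apply: measurableT_comp => //; exact: measurable_funB.
by apply/seteqP; split=> w /=; rewrite ltNge => /negP.
Qed.

(** Each block [M <= m < 2M] is charged to the average of [gamma] at its right
    end: the tested height [eps * M / 2] is [eps * (2M) / 4], which produces
    [(4 / eps) ^ p].  The factor [10 * W / eps] counts two checkpoints for each
    of at most [1 + 4 * W / eps <= 5 * W / eps] cells; this is where
    [eps <= 1 <= W] enters. *)
Lemma maximal_inequality (R : realType) (d : measure_display)
    (T : measurableType d) (P : probability T R) (p eps W c : R)
    (S : nat -> T -> R) (z gamma : nat -> R) (n : nat) :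
  1 <= p -> 0 < eps -> eps <= 1 -> 1 <= W -> (1 <= n)%N ->
  (forall m, 0 <= z m) -> (forall m, (1 <= m)%N -> z m <= W * m%:R) ->
  (forall m, measurable_fun setT (S m)) ->
  (forall w, {homo S^~ w : i j / (i <= j)%N >-> i <= j}) ->
  (forall k, (1 <= k)%N -> 0 <= gamma k) ->
  (forall m, (1 <= m)%N ->
     ('E_P[fun w => (`|S m w - z m| `^ p)%R] <= (psum gamma m)%:E)%E) ->
  (forall N, \sum_(n.+1 <= m < N) gamma m / m%:R `^ p <= c) ->
  (P (\bigcup_(m in [set m | (n <= m)%N])
        [set w | (eps * m%:R < `|S m w - z m|)%R])
    <= (10 * 4 `^ p * W / eps `^ (p + 1) *
        (psum gamma n / n%:R `^ p + 2 * c))%:E)%E.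
Proof.
move=> p1 e0 e1 W1 n1 z0 zW mS Shomo g0 SG gc.
have p0 : 0 <= p by lra.
pose M k := (n * 2 ^ k)%N.
have M0 k : (0 < M k)%N by rewrite muln_gt0 n1 expn_gt0.
have MS k : M k.+1 = (M k).*2 by rewrite /M expnSr mulnA muln2.
(* Half of the deviation eps * M k that has to be detected on the block. *)
pose h k := eps / 4 * (M k.+1)%:R.
have hh k : h k + h k = eps * (M k)%:R.
  by rewrite /h MS -muln2 natrM; field.
have h0 k : 0 < h k by rewrite mulr_gt0 ?ltr0n//; lra.
(* On the block z is at most 2 * W * M k = (4 * W / eps) * h k. *)
pose J := (Num.truncn (4 * W / eps)).+1.
have zJ k m : (M k <= m < (M k).*2)%N -> z m < J%:R * h k.
  move=> /andP[Mm m2M].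
  have /truncn_itv/andP[_] : 0 <= 4 * W / eps by rewrite divr_ge0//; lra.
  rewrite -/J ltr_pdivrMr// => WJ.
  have MR : (0 : R) < (M k.+1)%:R by rewrite ltr0n.
  have : W * m%:R <= W * (M k.+1)%:R.
    by rewrite ler_pM2l ?ler_nat ?MS ?(ltnW m2M)//; lra.
  have : 4 * W * (M k.+1)%:R < J%:R * eps * (M k.+1)%:R by rewrite ltr_pM2r.
  have := zW m (leq_trans (M0 k) Mm); rewrite /h; lra.
have JW : J%:R <= 5 * (W / eps).
  rewrite /J -natr1.
  have /truncn_itv/andP[tr _] : 0 <= 4 * W / eps by rewrite divr_ge0//; lra.
  have : 1 <= W / eps by rewrite ler_pdivlMr// mul1r; lra.
  by move: tr; rewrite -(mulrA 4); lra.
have [F FP] := choice (fun k => block_exceptional_set (M0 k) (h0 k) p0 z0 mS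
  Shomo (psum_nondecreasing g0) SG (zJ k)).
pose a k := psum gamma (M k) / (M k)%:R `^ p.
have a0 k : 0 <= a k.
  rewrite divr_ge0 ?powR_ge0// /psum big_nat sumr_ge0// => i /andP[i1 _].
  exact: g0.
set C := 10 * 4 `^ p * W / eps `^ (p + 1).
have powE : eps `^ (p + 1) = eps `^ p * eps.
  by rewrite powRD ?powRr1 ?(ltW e0)// (gt_eqF e0) implybT.
have C0 : 0 <= C by rewrite !mulr_ge0 ?powR_ge0 ?invr_ge0 ?powR_ge0//; lra.
apply: (@measure_bigcup_le_sum_bound _ _ _ P _ F (fun k => C * a k.+1)).
- exact: measurable_deviations.
- by move=> k; have [] := FP k.
- move=> w [m /= nm]; have [k kP] : exists k, (M k <= m < (M k).*2)%N.
    by apply: dyadic_block; rewrite n1.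
  move=> dev; exists k => //; have [_ _] := FP k; apply; first exact: kP.
  rewrite hh; apply: le_trans (ltW dev).
  by rewrite ler_pM2l// ler_nat; case/andP: kP.
- move=> k; have [_ + _] := FP k; move=> /le_trans; apply; rewrite lee_fin.
  have ep := powR_gt0 p e0; have fp : (0 : R) < 4 `^ p by rewrite powR_gt0.
  have mp : (0 : R) < (M k.+1)%:R `^ p by rewrite powR_gt0// ltr0n.
  have hE : h k `^ p = eps `^ p * (M k.+1)%:R `^ p / 4 `^ p.
    apply/(mulIf (lt0r_neq0 fp)); rewrite mulfVK ?lt0r_neq0//.
    rewrite -!powRM ?(ltW (h0 k)) ?(ltW e0)//; congr (_ `^ p).
    by rewrite /h; field.
  rewrite -MS -mulrnA -mulr_natr natrM hE /C powE /a.
  set x := psum _ _.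
  have x0 : 0 <= x * 4 `^ p / (eps `^ p * (M k.+1)%:R `^ p) * 2.
    have := a0 k.+1; rewrite pmulr_lge0 ?invr_gt0// => xa.
    by rewrite !(mulr_ge0, invr_ge0, powR_ge0).
  have := ler_wpM2l x0 JW.
  by congr (_ <= _); field; rewrite ?lt0r_neq0.
- move=> K; rewrite -mulr_sumr ler_wpM2l//.
  have := dyadic_average_sum_le K p1 g0 n1; rewrite -/(a K).
  have := gc (n * 2 ^ K).+1; have := a0 K.
  lra.
Qed.

(** * Choosing the threshold *)

Lemma partial_sum_le_nneseries (R : realType) (u : nat -> R) (a K : nat)
    (c : R) :
  (forall k, (a <= k)%N -> 0 <= u k) ->
  (\sum_(a <= i <oo) (u i)%:E <= c%:E)%E -> \sum_(a <= i < K) u i <= c.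
Proof.
move=> u0 uc; rewrite -lee_fin -sumEFin; apply: le_trans uc.
by apply: nneseries_lim_ge => k ak _; rewrite lee_fin u0.
Qed.

(** The terms up to [N] were divided by [m ^ p] in the series, and are now
    divided by [n ^ p], which is larger by a factor of at least [(n / N) ^ p];
    the terms after [N] are at most those of the series. *)
Lemma psum_split_average (R : realType) (p : R) (gamma : nat -> R) (N n : nat) :
  0 <= p -> (forall k, (1 <= k)%N -> 0 <= gamma k) -> (1 <= N <= n)%N ->
  psum gamma n / n%:R `^ p <=
    (N%:R / n%:R) `^ p * \sum_(1 <= m < N.+1) gamma m / m%:R `^ p
    + \sum_(N.+1 <= m < n.+1) gamma m / m%:R `^ p.
Proof.
move=> p0 g0 /andP[N1 Nn].
have mono i j : (0 < i <= j)%N -> (i%:R : R) `^ p <= j%:R `^ p.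
  by move=> /andP[_ ij]; rewrite ge0_ler_powR ?nnegrE ?ler_nat.
have pos i : (0 < i)%N -> 0 < (i%:R : R) `^ p.
  by move=> i0; rewrite powR_gt0// ltr0n.
have n0 : (0 < n)%N by lia.
have nE : (N%:R / n%:R) `^ p * n%:R `^ p = N%:R `^ p :> R.
  by rewrite -powRM// ?divr_ge0// divfK// pnatr_eq0; lia.
have NE : (N%:R / n%:R) `^ p = N%:R `^ p / n%:R `^ p :> R.
  by rewrite -nE mulfK// lt0r_neq0// pos.
rewrite /psum (big_cat_nat _ (n := N.+1))//= mulrDl lerD//.
  rewrite mulr_suml mulr_sumr ler_sum_nat// => i /andP[i1 iN].
  have ip := pos i i1; have np := pos n n0; have gi := g0 i i1.
  rewrite NE mulrCA [leRHS]mulrA -mulrA ler_wpM2l//.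
  rewrite mulrAC -[leLHS]mul1r ler_wpM2r ?invr_ge0 ?powR_ge0//.
  by rewrite ler_pdivlMr// mul1r mono// i1.
rewrite mulr_suml ler_sum_nat// => i /andP[Ni i_n].
have i0 : (0 < i)%N by lia.
rewrite ler_wpM2l ?g0// lef_pV2 ?posrE ?pos//.
by apply: mono; lia.
Qed.

(** The two summands on the left of the final bound get [lambda / 2] each: the
    argument of [Psi] is chosen for the tail of the series after [Psi], and the
    factor of [Psi] in the bound on [n] for the terms before it.  The parameter
    [e] stands for [eps ^ (p+1)]; the conditions [lambda <= 1] and [e <= 1] make
    that factor at least [1], so that [n] lies beyond [Psi]. *)
Lemma rate_threshold (R : realType) (p C W Gamma lambda e : R)
    (gamma : nat -> R) (Psi : R -> R) (n : nat) :
  1 <= p -> 1 <= C -> 1 <= W -> 1 <= Gamma ->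
  0 < lambda -> lambda <= 1 -> 0 < e -> e <= 1 ->
  (forall k, (1 <= k)%N -> 0 <= gamma k) ->
  (\sum_(1 <= m <oo) (gamma m / m%:R `^ p)%:E <= Gamma%:E)%E ->
  rate_of_convergence (fun m => gamma m / m%:R `^ p) Psi ->
  4 * C * (W * Gamma / (lambda * e)) `^ (1 / p)
    * Num.max 1 (Psi ((4 * C)^-1 * lambda * e / W)) <= n%:R ->
  exists2 c : R, forall K, \sum_(n.+1 <= m < K) gamma m / m%:R `^ p <= c &
    C * W / e * (psum gamma n / n%:R `^ p + 2 * c) <= lambda.
Proof.
move=> p1 C1 W1 G1 l0 l1 ep e_le1 g0 gG [_ PsiP] nA.
set q := W * Gamma / (lambda * e) in nA.
have q1 : 1 <= q.
  rewrite ler_pdivlMr ?mul1r ?mulr_gt0//.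
  have : lambda * e <= 1 by rewrite mulr_ile1// ltW.
  have : 1 <= W * Gamma by rewrite mulr_ege1.
  lra.
set del := (4 * C)^-1 * lambda * e / W in nA.
have del0 : 0 < del by rewrite !mulr_gt0 ?invr_gt0//; lra.
set x := Num.max 1 (Psi del) in nA.
have x1 : 1 <= x by rewrite le_max lexx.
have [N [N1 xN N2x]] : exists N : nat,
    [/\ (1 <= N)%N, x <= N%:R & N%:R <= 2 * x].
  exists (Num.truncn x).+1; have /truncn_itv/andP[] : 0 <= x by lra.
  by split=> //; [exact: ltW|rewrite -natr1; lra].
have rootq : 1 <= q `^ (1 / p).
  rewrite -[leLHS](powRr0 q) ler_powR// div1r invr_ge0; lra.
have CN : 2 * C * q `^ (1 / p) * N%:R <= n%:R.
  apply: le_trans nA.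
  have -> : 4 * C * q `^ (1 / p) * x = 2 * C * q `^ (1 / p) * (2 * x) by ring.
  by rewrite ler_wpM2l// mulr_ge0//; lra.
have Nn : (N <= n)%N.
  rewrite -(ler_nat R); apply: le_trans CN; rewrite -[leLHS]mul1r ler_wpM2r//.
  by rewrite mulr_ege1//; lra.
have u0 k : (1 <= k)%N -> 0 <= gamma k / k%:R `^ p.
  by move=> k1; rewrite divr_ge0 ?g0 ?powR_ge0.
have tail K : \sum_(N.+1 <= m < K) gamma m / m%:R `^ p <= del.
  apply: partial_sum_le_nneseries => [k Nk|]; first exact: u0 (leq_trans _ Nk).
  apply: PsiP => //; apply: (@le_trans _ _ x); last exact: xN.
  by rewrite le_max lexx orbT.
set D := \sum_(N.+1 <= m < n.+1) gamma m / m%:R `^ p.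
have D0 : 0 <= D.
  by rewrite /D big_nat sumr_ge0// => i /andP[Ni _]; exact: u0 (leq_trans _ Ni).
have tailn K : \sum_(n.+1 <= m < K) gamma m / m%:R `^ p <= del - D.
  have [nK|nK] := leqP n.+1 K.
    have := tail K; rewrite (big_cat_nat _ (n := n.+1))//=.
    by rewrite -/D; lra.
  by rewrite big_geq 1?ltnW// subr_ge0 tail.
(* The part D of the tail after N that lies before n enters through the average
   at n, and the rest bounds the tail after n. *)
exists (del - D); first exact: tailn.
have p0 : 0 <= p by lra.
have N1n : (1 <= N <= n)%N by rewrite N1.
have avg := psum_split_average p0 g0 N1n.
rewrite -/D in avg.
have head : \sum_(1 <= m < N.+1) gamma m / m%:R `^ p <= Gamma.
  exact: partial_sum_le_nneseries.
have ratio : (N%:R / n%:R) `^ p <= (2 * C * q)^-1.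
  have n0 : (0 : R) < n%:R by rewrite ltr0n (leq_trans N1).
  have q0 : 0 < q by lra.
  have r0 : 0 < q `^ (1 / p) by lra.
  have C0 : 0 < 2 * C by lra.
  have Cr0 : 0 < 2 * C * q `^ (1 / p) by rewrite mulr_gt0.
  have Nr : N%:R / n%:R <= (2 * C * q `^ (1 / p))^-1.
    by rewrite ler_pdivrMr// ler_pdivlMl.
  have Nr_pow : (N%:R / n%:R) `^ p <= (2 * C * q `^ (1 / p))^-1 `^ p.
    by apply: ge0_ler_powR; rewrite // nnegrE ?divr_ge0 ?invr_ge0// ltW.
  apply: le_trans Nr_pow _.
  rewrite -(powR_inv1 (ltW Cr0)) powRAC powR_inv1 ?powR_ge0//.
  have Cq0 : 0 < 2 * C * q by rewrite mulr_gt0.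
  rewrite lef_pV2 ?posrE ?powR_gt0//.
  rewrite powRM ?(ltW C0) ?(ltW r0)// -powRrM div1r mulVf; last by lra.
  rewrite (powRr1 (ltW q0)) ler_wpM2r ?(ltW q0)//.
  by apply: le1r_powR => //; lra.
have := ler_wpM2r (ltW (lt_le_trans ltr01 G1)) ratio.
have rG := ler_wpM2l (powR_ge0 (N%:R / n%:R) p) head.
move=> ratioG.
apply: (@le_trans _ _ (C * W / e * ((2 * C * q)^-1 * Gamma + 2 * del))).
  rewrite ler_wpM2l//; last by lra.
  by rewrite divr_ge0 ?mulr_ge0//; lra.
rewrite le_eqVlt; apply/orP; left; apply/eqP.
rewrite /q /del; field.
by rewrite ?lt0r_neq0//; lra.
Qed.

Theorem theorem1p9 (R : realType) (p : R) (hp : 1 <= p) :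
  exists A B : R, [/\ 0 < A, 0 < B &
    forall (d : measure_display) (T : measurableType d) (P : probability T R)
      (X : nat -> {RV P >-> R}) (mu gamma : nat -> R)
      (Gamma W : R) (Psi : R -> R),
    (forall k : nat, (1 <= k)%N -> forall w : T, 0 <= X k w) ->
    (forall k : nat, (1 <= k)%N ->
       ('E_P[fun w => (`|X k w| `^ p)%R] < +oo)%E) ->
    (forall k : nat, (1 <= k)%N -> ('E_P[X k] = (mu k)%:E)%E) ->
    (forall k : nat, (1 <= k)%N -> 0 <= gamma k) ->
    (forall n : nat, (1 <= n)%N ->
       ('E_P[fun w => (`|psum (fun k => X k w) n - psum mu n| `^ p)%R]
          <= (psum gamma n)%:E)%E) ->
    1 <= Gamma ->
    (\sum_(1 <= m <oo) (gamma m / (m%:R `^ p))%:E <= Gamma%:E)%E ->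
    rate_of_convergence (fun m : nat => gamma m / (m%:R `^ p)) Psi ->
    strictly_decreasing_pos Psi ->
    1 <= W ->
    (forall n : nat, (1 <= n)%N -> psum mu n / n%:R <= W) ->
    forall (eps lambda : R) (n : nat),
    0 < eps -> eps <= 1 -> 0 < lambda -> (1 <= n)%N ->
    A * (W * Gamma / (lambda * eps `^ (p + 1))) `^ (1 / p)
      * Num.max 1 (Psi (B * lambda * eps `^ (p + 1) / W)) <= n%:R ->
    (P [set w : T | (eps%:E <
          ereal_sup [set (`|psum (fun k => X k w) m / m%:R
                            - psum mu m / m%:R|)%R%:E
                    | m in [set m : nat | (n <= m)%N]])%E]
       <= lambda%:E)%E].
Proof.
set C : R := 10 * 4 `^ p.
have C1 : 1 <= C.
  have : (4 : R) <= 4 `^ p by apply: le1r_powR => //; lra.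
  by rewrite /C; lra.
exists (4 * C), (4 * C)^-1; split; [lra|by rewrite invr_gt0; lra|].
move=> d T P X mu gamma Gamma W Psi X0 _ XE g0 SG G1 gG PsiP _ W1 zW.
move=> eps lambda n e0 e1 l0 n1 nA.
pose S m w := psum (fun k => X k w) m.
pose z m := psum mu m.
have mu0 k : (1 <= k)%N -> 0 <= mu k.
  move=> k1; rewrite -lee_fin -XE//; apply: expectation_ge0; exact: X0.
have z0 m : 0 <= z m.
  by rewrite /z /psum big_nat sumr_ge0// => k /andP[k1 _]; exact: mu0.
have Shomo w : {homo S^~ w : i j / (i <= j)%N >-> i <= j}.
  by apply: psum_nondecreasing => k k1; exact: X0.
have mS m : measurable_fun setT (S m).
  by apply: measurable_sum => k; exact: measurable_funPT.
have supE : [set w : T | (eps%:E <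
    ereal_sup [set (`|psum (fun k => X k w) m / m%:R - psum mu m / m%:R|)%R%:E
              | m in [set m : nat | (n <= m)%N]])%E] =
  \bigcup_(m in [set m | (n <= m)%N])
     [set w | (eps * m%:R < `|S m w - z m|)%R].
  have dev m w : (n <= m)%N -> (eps < `|S m w / m%:R - z m / m%:R|) =
      (eps * m%:R < `|S m w - z m|).
    move=> nm; have m0 : (0 : R) < m%:R by rewrite ltr0n (leq_trans n1).
    by rewrite -mulrBl normrM normfV (gtr0_norm m0) ltr_pdivlMr.
  apply/seteqP; split=> w /=.
    move=> /ereal_sup_gt[_ [m /= nm <-]]; rewrite lte_fin => wm.
    by exists m => //=; rewrite -dev.
  move=> [m /= nm]; rewrite -dev// -lte_fin => /lt_le_trans; apply.
  by apply: ereal_sup_ubound; exists m.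
rewrite supE.
(* For lambda >= 1 the hypothesis on n may hold for n below the rate, but then
   the bound is trivial. *)
have [l1|l1] := leP 1 lambda.
  apply: (@le_trans _ _ 1%E); last by rewrite lee_fin.
  by apply: probability_le1; exact: measurable_deviations.
set e := eps `^ (p + 1) in nA *.
have ep : 0 < e by rewrite powR_gt0.
have e_le1 : e <= 1.
  have <- : (1 : R) `^ (p + 1) = 1 by rewrite powR1.
  by apply: ge0_ler_powR; rewrite ?nnegrE; lra.
have [c tailc lec] :=
  rate_threshold hp C1 W1 G1 l0 (ltW l1) ep e_le1 g0 gG PsiP nA.
have zW' m : (1 <= m)%N -> z m <= W * m%:R.
  by move=> m1; rewrite -ler_pdivrMr ?zW// ltr0n.
have := maximal_inequality hp e0 e1 W1 n1 z0 zW' mS Shomo g0 SG tailc.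
by move=> /le_trans; apply; rewrite lee_fin.
Qed.
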